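(* For every real number $t\in[0,1]$ there is a binary subordinate shift with entropy $t$; that is, there exists a sequence $x\in\{0,1\}^{\mathbb{N}}$ such that the subordinate shift $X^{\le x}\subset\{0,1\}^{\mathbb{N}}$ satisfies $h(X^{\le x})=t$.
   Context: $\mathbb{N}$ denotes the set of positive integers and $\log$ is the logarithm to base $2$. Let $\mathscr{A}$ be a finite set (alphabet). A block over $\mathscr{A}$ is a finite (possibly empty) sequence of symbols from $\mathscr{A}$; $\mathscr{A}^*$ is the set of all blocks; an $n$-block is a block of length $n$. A block $w$ occurs in $x=(x_i)_{i=1}^\infty\in\mathscr{A}^{\mathbb{N}}$ if $w=x_ix_{i+1}\ldots x_j$ for some integers $1\le i\le j$; the empty block occurs in every sequence. A shift space over $\mathscr{A}$ is a set $X\subset\mathscr{A}^{\mathbb{N}}$ for which there is a collection $\mathscr{F}\subset\mathscr{A}^*$ such that $X$ is the set of all sequences in $\mathscr{A}^{\mathbb{N}}$ in which no block from $\mathscr{F}$ occurs. The language $\mathscr{B}(X)$ of $X$ is the set of all blocks occurring in some sequence of $X$, and $\mathscr{B}_n(X)$ is the set of $n$-blocks in $\mathscr{B}(X)$. A shift space is determined by its language, and every set of blocks $\mathcal{L}\subset\mathscr{A}^*$ that is factorial ($vw\in\mathcal{L}$ implies $v,w\in\mathcal{L}$) and prolongable (for every $u\in\mathcal{L}$ there is $a\in\mathscr{A}$ with $ua\in\mathcal{L}$) is the language of the shift space with set of forbidden blocks $\mathscr{A}^*\setminus\mathcal{L}$. The entropy of a nonempty shift space $X$ is $h(X)=\lim_{n\to\infty}\frac1n\log|\mathscr{B}_n(X)|$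 (the limit exists by subadditivity and equals the infimum over $n\ge 1$). Subordinate shifts: let $\mathscr{A}=\{0,1,\ldots,r-1\}$. A block $w=w_1\ldots w_k$ dominates a block $v=v_1\ldots v_k$ of the same length if $v_i\le w_i$ for $i=1,\ldots,k$. For $x\in\mathscr{A}^{\mathbb{N}}$ let $\mathscr{B}_x$ be the set of all blocks occurring in $x$, and let $\mathscr{B}_x^{\le}$ be the set of all blocks over $\mathscr{A}$ dominated by some block in $\mathscr{B}_x$; this set is factorial and prolongable. The subordinate shift of $x$, denoted $X^{\le x}$, is the shift space over $\mathscr{A}$ whose language is $\mathscr{B}_x^{\le}$. Equivalently, $X^{\le x}$ is the set of all $y\in\mathscr{A}^{\mathbb{N}}$ such that every block occurring in $y$ is dominated by some block occurring in $x$. A binary subordinate shift is $X^{\le x}$ for some $x\in\{0,1\}^{\mathbb{N}}$ (alphabet $\{0,1\}$). *)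

(* Defs.v *)
From mathcomp Require Import all_boot all_order all_algebra.
From mathcomp Require Import all_classical all_reals all_analysis.

Set Implicit Arguments.
Unset Strict Implicit.
Unset Printing Implicit Defensive.

Import Order.TTheory GRing.Theory Num.Theory.
Import numFieldNormedType.Exports.

Local Open Scope classical_set_scope.
Local Open Scope ring_scope.

(* One-sided sequences over A are functions nat -> A, so positions start at 0
   instead of 1. *)

Definition block_at (A : Type) (x : nat -> A) (i n : nat) : seq A :=
  [seq x j | j <- iota i n].

Definition occurs (A : Type) (w : seq A) (x : nat -> A) : Prop :=
  exists i : nat, w = block_at x i (size w).

Definition shift_of_forbidden (A : Type) (F : set (seq A)) : set (nat -> A) :=
  [set x | forall w, F w -> ~ occurs w x].

Definition shift_space (A : finType) (X : set (nat -> A)) : Prop :=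
  exists F : set (seq A), X = shift_of_forbidden F.

Definition language (A : Type) (X : set (nat -> A)) : set (seq A) :=
  [set w | exists2 x, X x & occurs w x].

Definition nblocks (A : finType) (X : set (nat -> A)) (n : nat) :
    {set n.-tuple A} :=
  [set w : n.-tuple A | `[< language X w >]]%SET.

Definition log2 (R : realType) (a : R) : R := ln a / ln 2.

(* Nonemptiness is required because ln 0 = 0 would
   otherwise give the empty shift entropy 0.  The term n = 0, where the
   division by 0 returns 0, does not affect the limit. *)
Definition has_entropy (R : realType) (A : finType) (X : set (nat -> A))
    (h : R) : Prop :=
  [/\ shift_space X, X !=set0 &
      (fun n : nat => log2 (#|nblocks X n|%:R : R) / n%:R) @ \oo --> h].

(* all2 is false on sequences of different sizes, so w and v have the same
   length. *)
Definition dominates (r : nat) (w v : seq 'I_r) : bool :=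
  all2 (fun a b : 'I_r => (a <= b)%N) v w.

Definition dominated_blocks (r : nat) (x : nat -> 'I_r) : set (seq 'I_r) :=
  [set v | exists2 w, occurs w x & dominates w v].

Definition subordinate_shift (r : nat) (x : nat -> 'I_r) : set (nat -> 'I_r) :=
  shift_of_forbidden (~` dominated_blocks x).

Lemma language_subordinate_shift (r : nat) (x : nat -> 'I_r) :
  language (subordinate_shift x) = dominated_blocks x.
Proof.
have blockE (y : nat -> 'I_r) i n k : (k < n)%N ->
    nth (y 0%N) (block_at y i n) k = y (i + k)%N.
  by move=> kn; rewrite (nth_map 0%N) ?size_iota // nth_iota.
have dom_at (y z : nat -> 'I_r) i j n :
    (forall k, (k < n)%N -> (y (i + k) <= z (j + k))%N) ->
    dominates (block_at z j n) (block_at y i n).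
  elim: n i j => [//|n IHn] i j yz; rewrite /dominates /=; apply/andP; split.
    by have := yz 0%N isT; rewrite !addn0.
  by apply: IHn => k kn; rewrite !addSnnS; exact: yz.
apply/seteqP; split => [v [y yX vy]|v [w [i wx]] vw].
  by apply: contrapT => nv; exact: (yX v nv vy).
have sz : size v = size w by move: vw; rewrite /dominates all2E => /andP[/eqP].
pose y k := if (k < size v)%N then nth (x 0%N) v k else x (i + k)%N.
have yle k : (y k <= x (i + k))%N.
  rewrite /y; case: ltnP => // kv.
  have kw : (k < size w)%N by rewrite -sz.
  rewrite -(blockE x i (size w) k kw) -wx.
  have /all_nthP : all (fun p : 'I_r * 'I_r => (p.1 <= p.2)%N) (zip v w).
    by move: vw; rewrite /dominates all2E => /andP[].
  by move=> /(_ (x 0%N, x 0%N) k); rewrite size_zip -sz minnn nth_zip //=; apply.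
exists y.
  move=> u nu [j uy]; apply: nu; exists (block_at x (i + j) (size u)).
    by exists (i + j)%N; rewrite size_map size_iota.
  rewrite [X in dominates _ X]uy; apply: dom_at => k _.
  by rewrite -addnA; exact: yle.
exists 0%N; apply: (@eq_from_nth _ (x 0%N)); first by rewrite size_map size_iota.
move=> k kv; rewrite (nth_map 0%N) ?size_iota // nth_iota // add0n.
by rewrite /y kv.
Qed.

(* Main.v *)
(* Take for x the Sturmian sequence x_i = floor((i+1)t) - floor(it).  Every
   n-block of x has either floor(nt) or floor(nt) + 1 ones, and a block with m
   ones dominates 2^m blocks.  As x has only polynomially many n-blocks, the
   exponential growth rate of the language of its subordinate shift is exactly
   the density t of the ones. *)
Require Import Defs.
From mathcomp Require Import all_boot all_order all_algebra.
From mathcomp Require Import all_classical all_reals all_analysis.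
From mathcomp Require Import lra ring zify.

Import Order.TTheory GRing.Theory Num.Theory.
Import numFieldNormedType.Exports.

Set Implicit Arguments.
Unset Strict Implicit.
Unset Printing Implicit Defensive.

(** * Counting the blocks dominated by a given block *)

Lemma dominatesE (r n : nat) (w v : n.-tuple 'I_r) :
  dominates w v = [forall i, (tnth v i <= tnth w i)%N].
Proof.
rewrite /dominates all2E !size_tuple eqxx /=.
rewrite -[X in zip X _]map_tnth_enum -[X in zip _ X]map_tnth_enum zip_map all_map.
by apply/allP/forallP => vw i; [apply: vw; rewrite mem_enum | move=> _; exact: vw].
Qed.

(** Domination is a separate condition at each position, so the dominated blocks are the tuples of
    choice functions in a product family, and a letter [a] leaves [a.+1] choices. *)
Lemma card_dominated (r n : nat) (w : n.-tuple 'I_r) :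
  #|[set v : n.-tuple 'I_r | dominates w v]%SET| = \prod_(a <- w) a.+1.
Proof.
pose f (g : {ffun 'I_n -> 'I_r}) := [tuple g i | i < n].
have f_inj : injective f.
  move=> g h /(congr1 (@tnth _ _)) gh; apply/ffunP => i.
  by move: (congr1 (fun u => u i) gh); rewrite !tnth_mktuple.
pose F (i : 'I_n) : pred 'I_r := [pred a : 'I_r | (a <= tnth w i)%N].
have -> : [set v : n.-tuple 'I_r | dominates w v]%SET
    = (f @: [set g : {ffun 'I_n -> 'I_r} in family F])%SET.
  apply/setP => v; rewrite inE dominatesE; apply/forallP/imsetP => [vw|[g]].
    exists [ffun i => tnth v i]; last first.
      by apply: eq_from_tnth => i; rewrite tnth_mktuple ffunE.
    by rewrite inE; apply/familyP => i; rewrite ffunE inE.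
  by rewrite inE => /familyP gF -> i; rewrite tnth_mktuple; exact: gF.
rewrite card_imset // cardsE card_family foldrE big_map big_enum /= big_tuple.
apply: eq_bigr => i _; rewrite -sum1_card
  (eq_bigl (fun a : 'I_r => (a < (tnth w i).+1)%N)) //.
by rewrite (big_ord_narrow (ltn_ord (tnth w i))) sum_nat_const card_ord muln1.
Qed.

(** For a binary letter, [a.+1] equals [2 ^ a]. *)
Lemma card_dominated_binary (n : nat) (w : n.-tuple 'I_2) :
  #|[set v : n.-tuple 'I_2 | dominates w v]%SET| = (2 ^ \sum_(a <- w) a)%N.
Proof.
rewrite card_dominated expn_sum; apply: eq_bigr => a _.
by case: a => [[|[|a]]].
Qed.

Lemma sum_block_atS (r : nat) (x : nat -> 'I_r) (i k : nat) :
  (\sum_(a <- block_at x i k.+1) a =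
   \sum_(a <- block_at x i k) a + x (i + k))%N.
Proof. by rewrite /block_at -[k.+1]addn1 iotaD map_cat big_cat /= big_seq1. Qed.

(** * Bounds on the language of a subordinate shift *)

Definition occurring (A : finType) (x : nat -> A) (n : nat) : {set n.-tuple A} :=
  [set w : n.-tuple A | `[< occurs w x >]]%SET.

Lemma occurringP (A : finType) (x : nat -> A) (n : nat) (w : n.-tuple A) :
  reflect (exists i, val w = block_at x i n) (w \in occurring x n).
Proof.
rewrite inE; apply: (iffP (asboolP _)).
  by move=> [i wi]; exists i; rewrite [LHS]wi size_tuple.
by move=> [i wi]; exists i; rewrite size_tuple.
Qed.

Lemma nblocks_subordinate (r : nat) (x : nat -> 'I_r) (n : nat) :
  nblocks (subordinate_shift x) n =
  (\bigcup_(w in occurring x n) [set v : n.-tuple 'I_r | dominates w v])%SET.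
Proof.
apply/setP => v; rewrite inE language_subordinate_shift.
apply/asboolP/bigcupP => [[w wx wv]|[w + ]].
  have sw : size w == n.
    by move: wv; rewrite /dominates all2E size_tuple eq_sym => /andP[].
  by exists (Tuple sw); rewrite inE; [apply/asboolP; exact: wx|exact: wv].
by rewrite !inE => wx wv; exists w.
Qed.

Lemma card_nblocks_subordinate_ge (x : nat -> 'I_2) (i n : nat) :
  (2 ^ (\sum_(a <- block_at x i n) a) <= #|nblocks (subordinate_shift x) n|)%N.
Proof.
have sz : size (block_at x i n) == n by rewrite size_map size_iota.
rewrite -(card_dominated_binary (Tuple sz)) subset_leq_card //.
rewrite nblocks_subordinate; apply: (finset.bigcup_sup (Tuple sz)).
by apply/occurringP; exists i.
Qed.

(** Union bound: each occurring block contributes at most [2 ^ m] dominated blocks. *)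
Lemma card_nblocks_subordinate_le (x : nat -> 'I_2) (n m : nat) :
  (forall i, \sum_(a <- block_at x i n) a <= m)%N ->
  (#|nblocks (subordinate_shift x) n| <= #|occurring x n| * 2 ^ m)%N.
Proof.
move=> xm; rewrite nblocks_subordinate -sum_nat_const.
elim/big_ind2: _ => [|k A l B Ak Bl|w /occurringP[i wi]]; first by rewrite cards0.
  by apply: leq_trans (leq_of_leqif (leq_card_setU A B)) _; rewrite leq_add.
by rewrite card_dominated_binary leq_exp2l // wi.
Qed.

(** * The Sturmian sequence and its complexity *)

Local Open Scope ring_scope.

Definition beatty (R : realType) (t : R) (n : nat) : nat := Num.truncn (n%:R * t).

Definition sturmian (R : realType) (t : R) (i : nat) : 'I_2 :=
  inord (beatty t i.+1 - beatty t i).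

Section Sturmian.
Variables (R : realType) (t : R).
Hypothesis ht : 0 <= t <= 1.

Let beatty_itv n : (beatty t n)%:R <= n%:R * t < (beatty t n).+1%:R.
Proof. by apply: truncn_itv; case/andP: ht => t0 _; rewrite mulr_ge0. Qed.

(** The growth of the floor from [i] to [i + k] depends on [i] only through the fractional part of
    [i%:R * t], and monotonically; both the balance of the ones and the ordering of the blocks rest
    on this. *)
Lemma beattyD i k :
  (beatty t i + Num.truncn (i%:R * t - (beatty t i)%:R + k%:R * t)
   = beatty t (i + k))%N.
Proof.
have /andP[t0 _] := ht; have /andP[ti _] := beatty_itv i.
rewrite [RHS]/beatty -[X in (X + _)%N](natrK (R := R)) -truncnD ?natr_nat //.
  by congr (Num.truncn _); rewrite natrD; lra.
by rewrite nnegrE addr_ge0 ?subr_ge0 ?mulr_ge0.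
Qed.

(** As [t] lies in [0, 1], consecutive floors differ by 0 or 1, so neither the truncated subtraction
    nor [inord] falls back on a default value. *)
Lemma val_sturmian i : (beatty t i + sturmian t i = beatty t i.+1)%N.
Proof.
have /andP[t0 t1] := ht.
have le_b : (beatty t i <= beatty t i.+1)%N.
  by apply: le_truncn; rewrite ler_wpM2r // ler_nat.
have lt_b : (beatty t i.+1 < (beatty t i).+2)%N.
  have /andP[_ bi] := beatty_itv i; have /andP[bi' _] := beatty_itv i.+1.
  rewrite -(ltr_nat R); apply: le_lt_trans bi' _.
  by rewrite -natr1 -[in ltRHS]natr1; lra.
by rewrite /sturmian inordK; lia.
Qed.

(** The letters telescope to a difference of two floors. *)
Lemma sum_sturmian i k :
  (\sum_(a <- block_at (sturmian t) i k) a =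
   Num.truncn (i%:R * t - (beatty t i)%:R + k%:R * t))%N.
Proof.
apply/eqP; rewrite -(eqn_add2l (beatty t i)) beattyD; apply/eqP.
elim: k => [|k IHk]; first by rewrite big_nil !addn0.
rewrite sum_block_atS addnA IHk.
by rewrite val_sturmian addnS.
Qed.

(** A fractional part below 1 raises the floor of [k%:R * t] by at most one. *)
Lemma sum_sturmian_le i k :
  (\sum_(a <- block_at (sturmian t) i k) a <= (beatty t k).+1)%N.
Proof.
have /andP[t0 _] := ht; have /andP[_ bi] := beatty_itv i.
have /andP[_ bk] := beatty_itv k.
rewrite sum_sturmian truncn_le_nat; move: bi bk.
by rewrite -!natr1; lra.
Qed.

(* Ordering the starting positions by the fractional part of i t orders their
   blocks, so a block is determined by the sum of its partial sums. *)
Lemma card_occurring_sturmian n :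
  (#|occurring (sturmian t) n| <= n.+1 ^ 2)%N.
Proof.
pose S (w : seq 'I_2) : nat := (\sum_(k < n.+1) \sum_(a <- take k w) a)%N.
pose d i (k : nat) : nat := (\sum_(a <- block_at (sturmian t) i k) a)%N.
have SE i : S (block_at (sturmian t) i n) = (\sum_(k < n.+1) d i k)%N.
  apply: eq_bigr => k _; rewrite /d /block_at -map_take take_iota.
  by have /minn_idPl -> : (k <= n)%N by rewrite -ltnS.
have d_le i k : (d i k <= k)%N.
  rewrite /d -[leqRHS](size_iota i) -sum1_size big_map.
  by apply: leq_sum => j _; rewrite -ltnS.
have S_lt w : w \in occurring (sturmian t) n -> (S w < n.+1 ^ 2)%N.
  move=> /occurringP[i ->]; rewrite SE.
  apply: (@leq_ltn_trans (\sum_(k < n.+1) n)); last first.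
    by rewrite sum_nat_const card_ord -mulnn ltn_pmul2l.
  by apply: leq_sum => k _; apply: leq_trans (d_le _ _) _; rewrite -ltnS.
have d_inj i j : (forall k, d i k <= d j k)%N ->
    (\sum_(k < n.+1) d i k = \sum_(k < n.+1) d j k)%N ->
    block_at (sturmian t) i n = block_at (sturmian t) j n.
  move=> dij Sij.
  (* Termwise inequalities between equal totals are all equalities. *)
  have {}Sij k : (k <= n)%N -> d i k = d j k.
    move=> kn; pose k' := Ordinal (kn : (k < n.+1)%N).
    have [_] := @leqif_sum _ xpredT _ _ _
                  (fun (l : 'I_n.+1) _ => leqif_eq (dij l)).
    by rewrite Sij eqxx => /esym/forallP /(_ k') /eqP.
  (* Letters are recovered as differences of consecutive partial sums. *)
  have dS l k : d l k.+1 = (d l k + sturmian t (l + k))%N.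
    exact: sum_block_atS.
  apply: (@eq_from_nth _ ord0); rewrite !size_map !size_iota // => k kn.
  rewrite !(nth_map 0%N) ?size_iota // !nth_iota //; apply: val_inj => /=.
  by have := Sij k.+1 kn; rewrite !dS (Sij k (ltnW kn)) => /addnI.
pose f (w : n.-tuple 'I_2) : 'I_(n.+1 ^ 2).-1.+1 := inord (S w).
rewrite -[leqRHS](card_ord) -(prednK (_ : 0 < n.+1 ^ 2)%N) ?expn_gt0 //.
apply: (leq_card_in f) => v w vx wx /(congr1 val).
rewrite /= !inordK ?prednK ?expn_gt0 //; try exact: S_lt.
move: vx wx => /occurringP[i vi] /occurringP[j wj].
rewrite vi wj !SE => Sij; apply: val_inj; rewrite vi wj.
have [le_fr|/ltW le_fr] := leP (i%:R * t - (beatty t i)%:R)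
                              (j%:R * t - (beatty t j)%:R).
  by apply: d_inj Sij => k; rewrite /d !sum_sturmian le_truncn // lerD2r.
apply/esym; apply: d_inj (esym Sij) => k.
by rewrite /d !sum_sturmian le_truncn // lerD2r.
Qed.

(** * Growth of the block counts and the limit *)

Lemma card_nblocks_sturmian_ge n :
  (2 ^ beatty t n <= #|nblocks (subordinate_shift (sturmian t)) n|)%N.
Proof.
(* At position 0 the fractional part vanishes, so the initial block has exactly [beatty t n]
   ones. *)
have b0 : beatty t 0 = 0%N by rewrite /beatty mul0r truncn0.
have := card_nblocks_subordinate_ge (sturmian t) 0 n.
by rewrite sum_sturmian b0 mul0r subr0 add0r.
Qed.

Lemma card_nblocks_sturmian_le n :
  (#|nblocks (subordinate_shift (sturmian t)) n|
     <= n.+1 ^ 2 * 2 ^ (beatty t n).+1)%N.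
Proof.
apply: leq_trans (leq_mul (card_occurring_sturmian n) (leqnn _)).
by apply: card_nblocks_subordinate_le => i; exact: sum_sturmian_le.
Qed.

Lemma log2_nblocks_sturmian_ge n :
  n%:R * t - 1 <= log2 (#|nblocks (subordinate_shift (sturmian t)) n|%:R : R).
Proof.
have ln2_gt0 : 0 < ln 2 :> R by rewrite ln_gt0 // ltr1n.
have /andP[_ bn] := beatty_itv n.
apply: (@le_trans _ _ (beatty t n)%:R); first by move: bn; rewrite -natr1; lra.
rewrite ler_pdivlMr // mulr_natl -lnXn // ler_ln ?posrE ?exprn_gt0 //.
  by rewrite -natrX ler_nat card_nblocks_sturmian_ge.
by rewrite ltr0n (leq_trans _ (card_nblocks_sturmian_ge n)) ?expn_gt0.
Qed.

Lemma log2_nblocks_sturmian_le n :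
  log2 (#|nblocks (subordinate_shift (sturmian t)) n|%:R : R)
    <= n%:R * t + 1 + 2 * log2 (n.+1%:R : R).
Proof.
have ln2_gt0 : 0 < ln 2 :> R by rewrite ln_gt0 // ltr1n.
have /andP[bn _] := beatty_itv n.
apply: (@le_trans _ _ ((beatty t n).+1%:R + 2 * log2 (n.+1%:R : R))); last first.
  by rewrite lerD2r -natr1 lerD2r.
rewrite /log2 ler_pdivrMr // mulrDl -mulrA divfK ?gt_eqF //.
rewrite !mulr_natl -!lnXn ?ltr0n // addrC -lnM ?posrE ?exprn_gt0 ?ltr0n //.
rewrite ler_ln ?posrE ?mulr_gt0 ?exprn_gt0 ?ltr0n //.
  by rewrite -!natrX -natrM ler_nat card_nblocks_sturmian_le.
by rewrite (leq_trans _ (card_nblocks_sturmian_ge n)) ?expn_gt0.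
Qed.

End Sturmian.

(** Apply [ln y < y] to the square root of [a]. This crude bound suffices to make the logarithm of
    the polynomial factor negligible against [n]. *)
Lemma ln_le_sqrt (R : realType) (a : R) : 0 < a -> ln a <= 2 * Num.sqrt a.
Proof.
move=> a0; rewrite -[in leLHS](sqr_sqrtr (ltW a0)) lnXn ?sqrtr_gt0 //.
by rewrite -[_ *+ 2]mulr_natl ler_pM2l // ltW // ln_sublinear // sqrtr_gt0.
Qed.

Theorem theorem3 (R : realType) (t : R) (ht : 0 <= t <= 1) :
  exists x : nat -> 'I_2, has_entropy (subordinate_shift x) t.
Proof.
exists (sturmian t); split; first by exists (~` dominated_blocks (sturmian t))%classic.
  (* The sequence lies in its own subordinate shift, since every block dominates itself. *)
  exists (sturmian t) => w + wx; apply; exists w => //.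
  by rewrite /dominates; elim: (w) => //= a u ->; rewrite leqnn.
(* For positive [n], [H n] bounds [1 / n] and [K n] bounds [2 * log2 n.+1%:R / n]. The 4 in [C] is
   the 2 of [ln_le_sqrt] times the 2 of [n + 1 <= 2 * n]; using [n.+1] allows comparison with the
   harmonic sequence. *)
pose C : R := 4 / ln 2.
pose H : nat -> R := fun n => 2 * n.+1%:R^-1.
pose K : nat -> R := fun n => 2 * C * Num.sqrt n.+1%:R^-1.
have H0 : (H @ \oo --> 0)%classic.
  by rewrite -[X in (_ --> X)%classic](mulr0 2); apply: cvgMl_tmp; exact: cvg_harmonic.
have K0 : (K @ \oo --> 0)%classic.
  rewrite -[X in (_ --> X)%classic](mulr0 (2 * C)) -(sqrtr0 R).
  apply: cvgMl_tmp; apply: (cvg_comp _ _ (cvg_harmonic (R := R))).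
  exact: sqrt_continuous.
have ln2_gt0 : 0 < ln 2 :> R by rewrite ln_gt0 // ltr1n.
apply: (@squeeze_cvgr _ _ _ _ (fun n => t - H n) (fun n => t + H n + K n)).
- near=> n.
  have n0 : 0 < n%:R :> R by rewrite ltr0n; near: n; exact: nbhs_infty_gt.
  have n1 : 1 <= n%:R :> R by rewrite ler1n -(ltr0n R).
  have invn : n%:R^-1 <= 2 * n.+1%:R^-1 :> R.
    rewrite -natr1 ler_pdivlMr ?addr_gt0 // mulrC ler_pdivrMr //; lra.
  have Hn : 1 <= H n * n%:R by rewrite -ler_pdivrMr // div1r.
  rewrite ler_pdivlMr // ler_pdivrMr //; apply/andP; split.
    by apply: le_trans (log2_nblocks_sturmian_ge ht n); lra.
  apply: le_trans (log2_nblocks_sturmian_le ht n) _.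
  suff: 2 * log2 n.+1%:R <= K n * n%:R by lra.
  have s0 : 0 < Num.sqrt n.+1%:R :> R by rewrite sqrtr_gt0 ltr0n.
  have sE : n.+1%:R = Num.sqrt n.+1%:R ^+ 2 :> R by rewrite sqr_sqrtr.
  have ln_s := @ln_le_sqrt R _ (ltr0Sn R n).
  (* This is [n + 1 <= 2 * n] divided by the square root. *)
  have le_s : Num.sqrt n.+1%:R <= 2 * n%:R / Num.sqrt n.+1%:R :> R.
    by rewrite ler_pdivlMr // -expr2 -sE -natr1; lra.
  rewrite /K /C /log2 sqrtrV //.
  rewrite [leRHS](_ : _ =
      2 * (2 * (2 * n%:R / Num.sqrt n.+1%:R) / ln 2)); last by ring.
  by rewrite ler_pM2l // ler_pM2r ?invr_gt0 //; lra.
- by rewrite -[X in (_ --> X)%classic]subr0; apply: cvgB => //; exact: cvg_cst.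
- rewrite -[X in (_ --> X)%classic]addr0; apply: cvgD => //.
  by rewrite -[X in (_ --> X)%classic]addr0; apply: cvgD => //; exact: cvg_cst.
Unshelve. all: by end_near.
Qed.
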